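(* Let $M\in\mathbb{R}^{n\times n}$ be symmetric positive definite and tridiagonal, with smallest and largest eigenvalues $\lambda_{\min}$ and $\lambda_{\max}$, and let $S=M\otimes I_n+I_n\otimes M$. For $k,t\in\{1,\ldots,n^2\}$ let $$j=\lfloor (t-1)/n\rfloor+1,\quad i=t-n\lfloor (t-1)/n\rfloor,\quad m=\lfloor (k-1)/n\rfloor+1,\quad \ell=k-n\lfloor (k-1)/n\rfloor .$$ Let $R=R(\omega)$ be the function of $\omega\in\mathbb{R}$ defined in the context. Then the following holds. (i) If $i\ne\ell$ and $j\ne m$, then $$|(S^{-1})_{k,t}|\le \frac{1}{2\pi}\,\frac{64}{|\lambda_{\max}-\lambda_{\min}|^2}\int_{-\infty}^{\infty}\left(\frac{R^2}{(R^2-1)^2}\right)^2\left(\frac1R\right)^{|i-\ell|+|j-m|-2}\,d\omega .$$ (ii) If either $i=\ell$ or $j=m$ (but not both), then $$|(S^{-1})_{k,t}|\le \frac{1}{2\pi}\,\frac{8}{|\lambda_{\max}-\lambda_{\min}|}\int_{-\infty}^{\infty}\frac{1}{\sqrt{\lambda_{\min}^2+\omega^2}}\,\frac{R^2}{(R^2-1)^2}\left(\frac1R\right)^{|i-\ell|+|j-m|-1}\,d\omega .$$ (iii) If both $i=\ell$ and $j=m$, then $$|(S^{-1})_{k,t}|\le \frac{1}{2\pi}\int_{-\infty}^{\infty}\frac{1}{\lambda_{\min}^2+\omega^2}\,d\omega=\frac{1}{2\lambda_{\min}} .$$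
   Context: $I_n$ is the $n\times n$ identity matrix and $\otimes$ is the Kronecker product. For $\omega\in\mathbb{R}$ put $\lambda_1=\lambda_{\min}+\imath\omega$, $\lambda_2=\lambda_{\max}+\imath\omega$ (with $\imath^2=-1$), $$\alpha=\alpha(\omega)=\frac{|\lambda_1|+|\lambda_2|}{|\lambda_2-\lambda_1|},\qquad R=R(\omega)=\alpha+\sqrt{\alpha^2-1}>1 .$$ (The definition of $\alpha$ presupposes $\lambda_{\max}\neq\lambda_{\min}$.) *)

(* Defs.v *)
From mathcomp Require Import all_boot all_order all_algebra.
From mathcomp Require Import all_classical all_reals all_analysis.
From mathcomp Require Import complex mxtens.

Set Implicit Arguments.
Unset Strict Implicit.
Unset Printing Implicit Defensive.

Import Order.TTheory GRing.Theory Num.Theory.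
Import numFieldNormedType.Exports.
Local Open Scope ring_scope.
Local Open Scope complex_scope.

Definition posdefmx (R : realType) (n : nat) (M : 'M[R]_n) : Prop :=
  forall x : 'cV[R]_n, x != 0 -> 0 < (x^T *m M *m x) 0 0.

Definition tridiagmx (R : realType) (n : nat) (M : 'M[R]_n) : Prop :=
  forall i j : 'I_n, (1 < `|i - j|)%N -> M i j = 0.

Definition min_eigenvalue (R : realType) (n : nat) (M : 'M[R]_n) (a : R) : Prop :=
  eigenvalue M a /\ forall b : R, eigenvalue M b -> a <= b.

Definition max_eigenvalue (R : realType) (n : nat) (M : 'M[R]_n) (a : R) : Prop :=
  eigenvalue M a /\ forall b : R, eigenvalue M b -> b <= a.

(* [tensmx A B] has entry [A (s %/ n) (t %/ n) * B (s %% n) (t %% n)] at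
   (0-based) position (s, t), i.e. it is the usual Kronecker product. *)
Definition kronsum (R : realType) (n : nat) (M : 'M[R]_n) : 'M[R]_(n * n) :=
  tensmx M 1%:M + tensmx 1%:M M.

(* Here t is 1-based: for t in {1, .., n ^ 2} both indices are in {1, .., n}. *)
Definition outer_index (n t : nat) : nat := ((t - 1) %/ n + 1)%N.
Definition inner_index (n t : nat) : nat := (t - n * ((t - 1) %/ n))%N.

(* [Normc.normc] is the complex modulus, with values in R rather than R[i]. *)
Definition alpha (R : realType) (lmin lmax w : R) : R :=
  let l1 := lmin +i* w in
  let l2 := lmax +i* w in
  (Normc.normc l1 + Normc.normc l2) / Normc.normc (l2 - l1).

Definition Rfun (R : realType) (lmin lmax w : R) : R :=
  alpha lmin lmax w + Num.sqrt (alpha lmin lmax w ^+ 2 - 1).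

(* Main.v *)
Require Import Defs.
From mathcomp Require Import all_boot all_order all_algebra.
From mathcomp Require Import all_classical all_reals all_analysis.
From mathcomp Require Import complex mxtens.
From mathcomp Require Import ring lra zify spectral measurable_realfun.

Set Implicit Arguments.
Unset Strict Implicit.
Unset Printing Implicit Defensive.

Import Order.TTheory GRing.Theory Num.Theory.
Import numFieldNormedType.Exports.
Local Open Scope ring_scope.

(** The identity 1/(c + d) = (1/2 pi) int dw / ((c + iw)(d - iw)), for c, d > 0,
    applied to the eigenvalues of M, turns every entry of S^-1 into
    (1/2 pi) times the integral of Re (F(w) * conj G(w)), where F(w) and G(w)
    are the entries of the resolvent (M + iw)^-1 at the outer and at the inner
    pair of indices.  It then suffices to bound a single resolvent entry.

    A symmetric M has a resolution of the identity 1 = sum_s E_s with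
    M E_s = d_s E_s, in which the absolute values of the E_s sum to at most 1
    at each position (a, b) ([sym_spectral_resolution]).  Hence
    F(w) = sum_s E_s(a, b) / (d_s + iw), which is at most
    1 / sqrt (lmin^2 + w^2) in modulus ([resolvent_le]); this settles a pair of
    equal indices.

    For a <> b the powers M^k with k < |a - b| vanish at (a, b), since M is
    tridiagonal, so that the weights E_s(a, b) annihilate all polynomials of
    degree less than |a - b|.  Therefore 1 / (d_s + iw) may be replaced by the
    error of a polynomial approximation of degree |a - b| - 1.  After an affine
    change of variable the spectrum lies in [-2, 2] and the pole at
    rho + 1/rho, where |rho| = R(w) ([Rfun_joukowski]).  With sg = 1/rho and
    y = v + 1/v, the symmetric Laurent polynomial
      v^N (v - sg) (1 - conj sg / v) + v^-N (1/v - sg) (1 - conj sg * v)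
    is a polynomial Q(y) of degree N + 1 ([joukowski_polyP]).  On |v| = 1 both
    summands have modulus |y - rho - 1/rho| / R, while at the pole the second
    summand vanishes, so that |Q| is there at least R^(N-3) (R^2 - 1)^2.  The
    error Q(y) / (Q(pole) (y - pole)) is thus at most
    2 R^2 / (R^2 - 1)^2 * R^-N ([cauchy_transform_le]), which is the constant
    required. *)

(** * Spectral resolution of a symmetric matrix *)

(** Conjugate by a unitary matrix P over R[i]: the rank-one projections are
    conj (P s a) * P s b, and as M and its eigenvalues are real, their real
    parts still satisfy M E_s = d_s E_s and still sum to the identity.  The real
    parts need not be projections any more, but only linear consequences are
    used below.  The bound is Cauchy-Schwarz for two columns of P, both of norm
    1. *)
Lemma sym_spectral_resolution (R : rcfType) (n : nat) (M : 'M[R]_n) :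
  M^T = M ->
  exists (d : 'I_n -> R) (E : 'I_n -> 'M[R]_n),
    [/\ forall s, eigenvalue M (d s), forall s, M *m E s = d s *: E s,
        \sum_s E s = 1%:M & forall a b, \sum_s `|E s a b| <= 1].
Proof.
move=> M_sym.
pose A : 'M[R[i]]_n := map_mx (real_complex R) M.
have A_real : A \is a mxOver Num.real.
  by apply/mxOverP => a b; rewrite mxE complex_real.
have A_symm : A \is symmetricmx.
  by apply/is_hermitianmxP; rewrite expr0 scale1r map_mx_id// /A map_trmx M_sym.
have A_herm := realsym_hermsym A_symm A_real.
have /hermitian_normalmx/orthomx_spectralP := A_herm.
have := hermitian_spectral_diag_real A_herm.
have := spectral_unitarymx A.
set P := spectralmx A; set D := spectral_diag A => P_unitary D_real.
have P_unit := unitarymx_unit P_unitary.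
rewrite invmx_unitary// => A_eq.
have PPstar : P *m (P ^t* )%sesqui = 1%:M by exact/unitarymxP.
have PstarP : (P ^t* )%sesqui *m P = 1%:M by exact: mulmx1C.
pose d s := complex.Re (D 0 s).
have dE s : D 0 s = (d s)%:C%C by rewrite RRe_real//; exact: (mxOverP D_real).
pose Ec s a b := (P s a)^*%R * P s b.
have sumEc a b : \sum_s Ec s a b = (a == b)%:R.
  move/matrixP/(_ a b): PstarP; rewrite !mxE => <-.
  by apply: eq_bigr => s _; rewrite !mxE.
exists d, (fun s => \matrix_(a, b) complex.Re (Ec s a b)); split.
(* Eigenvalues descend to R because the characteristic polynomials agree. *)
- move=> s; rewrite eigenvalue_root_char -(fmorph_root (real_complex R)).
  rewrite map_char_poly -eigenvalue_root_char -/A.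
  apply/eigenvalueP; exists (row s P).
    rewrite A_eq !mulmxA -row_mul PPstar -row_mul mul1mx.
    by rewrite row_diag_mx -scalemxAl -rowE dE.
  apply/eqP => Ps0; have := congr1 (fun Q => row s Q 0 s) PPstar.
  by rewrite row_mul Ps0 mul0mx !mxE eqxx; apply/eqP; rewrite eq_sym oner_eq0.
- move=> s; apply/matrixP => a b; rewrite !mxE.
  have : \sum_c A a c * Ec s c b = (d s)%:C%C * Ec s a b.
    have : A *m (P ^t* )%sesqui = (P ^t* )%sesqui *m diag_mx D.
      by rewrite A_eq -!mulmxA PPstar mulmx1.
    move/matrixP/(_ a s); rewrite mul_mx_diag !mxE => AP.
    rewrite /Ec -dE [D 0 s * _]mulrA [D 0 s * _]mulrC -AP mulr_suml.
    by apply: eq_bigr => c _; rewrite !mxE mulrA.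
  move/(congr1 (@complex.Re R)); rewrite raddf_sum/=.
  have ReM (x : R) (z : R[i]) : complex.Re (x%:C%C * z) = x * complex.Re z.
    by case: z => u v /=; rewrite mul0r subr0.
  by rewrite ReM => <-; apply: eq_bigr => c _; rewrite !mxE ReM.
- apply/matrixP => a b; rewrite summxE.
  under eq_bigr do rewrite mxE.
  by rewrite -raddf_sum/= sumEc mxE; case: (a == b).
- move=> a b; rewrite -lecR rmorph_sum rmorph1/=.
  (* |xy| <= (|x|^2 + |y|^2) / 2 termwise, and columns of P have norm 1. *)
  have -> : 1 = 2^-1 * (\sum_s Ec s a a + \sum_s Ec s b b) :> R[i].
    by rewrite !sumEc !eqxx -mulr2n mulVf// pnatr_eq0.
  rewrite -big_split mulr_sumr; apply: ler_sum => s _ /=.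
  rewrite mxE (le_trans (normc_ge_Re _))// /Ec normrM norm_conjC.
  rewrite ![_^* * _]mulrC -!normCK ler_pdivlMl ?ltr0n//.
  rewrite -subr_ge0.
  have -> : `|P s a| ^+ 2 + `|P s b| ^+ 2 - 2 * (`|P s a| * `|P s b|) =
      (`|P s a| - `|P s b|) ^+ 2 by ring.
  by apply: real_exprn_even_ge0 => //; rewrite realB.
Qed.

(** * Tridiagonal matrices and vanishing moments *)

(** The sum is the (a, b) entry of M^k, and a path of k steps between
    neighbouring indices cannot join a to b. *)
Lemma tridiag_moment0 (R : realType) (n : nat) (M : 'M[R]_n)
    (d : 'I_n -> R) (E : 'I_n -> 'M[R]_n) :
  tridiagmx M -> (forall s, M *m E s = d s *: E s) -> \sum_s E s = 1%:M ->
  forall k (a b : 'I_n), (k < `|a - b|)%N -> \sum_s E s a b * d s ^+ k = 0.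
Proof.
move=> M_tridiag ME sumE; elim=> [|k IHk] a b.
  move=> ab; under eq_bigr do rewrite mulr1.
  rewrite -summxE sumE mxE; case: eqP ab => [->|//].
  by rewrite distnn.
move=> ab; pose r c := \sum_s E s c b * d s ^+ k.
have -> : \sum_s E s a b * d s ^+ k.+1 = \sum_c M a c * r c.
  under [RHS]eq_bigr do rewrite mulr_sumr.
  rewrite exchange_big; apply: eq_bigr => s _ /=.
  have /matrixP/(_ a b) := ME s; rewrite !mxE exprS mulrA => /esym.
  rewrite [d s * _]mulrC => ->; rewrite mulr_suml.
  by apply: eq_bigr => c _; rewrite mulrA.
apply: big1 => c _; have [ac|ac] := ltnP 1 `|a - c|.
  by rewrite M_tridiag// mul0r.
rewrite /r IHk ?mulr0//.
have := leqD_dist a c b; lia.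
Qed.

Lemma tridiag_poly0 (R : realType) (n : nat) (M : 'M[R]_n)
    (d : 'I_n -> R) (E : 'I_n -> 'M[R]_n) :
  tridiagmx M -> (forall s, M *m E s = d s *: E s) -> \sum_s E s = 1%:M ->
  forall (a b : 'I_n) (P : {poly R[i]}), (size P <= `|a - b|)%N ->
  \sum_s (E s a b)%:C%C * P.[(d s)%:C%C] = 0.
Proof.
move=> M_tridiag ME sumE a b P sP.
under eq_bigr do rewrite horner_coef mulr_sumr.
rewrite exchange_big; apply: big1 => k _ /=.
have := tridiag_moment0 M_tridiag ME sumE (leq_trans (ltn_ord k) sP).
move=> /(congr1 (real_complex R)); rewrite rmorph_sum rmorph0/= => E0.
transitivity (P`_k * \sum_s (E s a b * d s ^+ k)%:C%C); last by rewrite E0 mulr0.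
rewrite mulr_sumr; apply: eq_bigr => s _.
by rewrite rmorphM rmorphXn/= mulrCA.
Qed.

(** * Polynomial approximation of a simple pole on an interval *)

(** Each of the two summands satisfies the recurrence of the Chebyshev
    polynomials in v + w, because v and w are the roots of
    z^2 - (v + w) z + 1.  The factor 1 - t w stands for (v - t) / v; in this form no
    negative power is needed when N = 0. *)
Lemma joukowski_polyP (F : comNzRingType) (s t : F) (N : nat) :
  exists2 Q : {poly F}, (size Q <= N.+2)%N &
    forall v w, v * w = 1 ->
      Q.[v + w] = v ^+ N * ((v - s) * (1 - t * w)) +
                  w ^+ N * ((w - s) * (1 - t * v)).
Proof.
suff [Q [Q' [sQ _ QE _]]] : exists Q Q' : {poly F},
    [/\ (size Q <= N.+2)%N, (size Q' <= N.+3)%N,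
        forall v w, v * w = 1 -> Q.[v + w] =
          v ^+ N * ((v - s) * (1 - t * w)) + w ^+ N * ((w - s) * (1 - t * v)) &
        forall v w, v * w = 1 -> Q'.[v + w] =
          v ^+ N.+1 * ((v - s) * (1 - t * w)) +
          w ^+ N.+1 * ((w - s) * (1 - t * v))] by exists Q.
elim: N => [|N [Q [Q' [sQ sQ' QE Q'E]]]].
  exists ((1 + s * t)%:P * 'X - (2 * (s + t))%:P).
  exists ('X ^+ 2 - (s + t)%:P * 'X + (2 * (s * t - 1))%:P); split.
  - rewrite (leq_trans (size_polyD _ _))// geq_max size_polyN.
    rewrite (leq_trans (size_polyMleq _ _)) ?size_polyX/=.
      by rewrite (leq_trans (size_polyC_leq1 _)).
    by rewrite addn2/= ltnS size_polyC_leq1.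
  - rewrite (leq_trans (size_polyD _ _))// geq_max.
    rewrite (leq_trans (size_polyD _ _))// ?geq_max ?size_polyN ?size_polyXn//=.
      by rewrite (leq_trans (size_polyC_leq1 _)).
    rewrite (leq_trans (size_polyMleq _ _))// size_polyX addn2/=.
    by rewrite (leq_ltn_trans (size_polyC_leq1 _)).
  - move=> v w vw.
    by rewrite !(hornerD, hornerN, hornerM, hornerXn, hornerX, hornerC); ring: vw.
  - move=> v w vw.
    by rewrite !(hornerD, hornerN, hornerM, hornerXn, hornerX, hornerC); ring: vw.
exists Q', ('X * Q' - Q); split => //.
  rewrite (leq_trans (size_polyD _ _))// geq_max size_polyN.
  rewrite (leq_trans (size_polyMleq _ _)) ?size_polyX ?add2n//=.
  by rewrite (leq_trans sQ)// ltnW.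
move=> v w vw; rewrite hornerD hornerN hornerM hornerX QE// Q'E//.
by rewrite !exprS; ring: vw.
Qed.
(** The weights do not distinguish 1 / (y - a) from Q(y) / (Q(a) (y - a)), for Q of
    degree N + 1, because the difference is a polynomial of degree N.  Here a is
    rho + 1/rho, and Q comes from [joukowski_polyP] with s = 1/rho and t = conj s. *)
Lemma cauchy_transform_le (R : rcfType) (I : finType) (e y : I -> R) (N : nat)
    (rho : R[i]) :
  (forall s, `|y s| <= 2) -> \sum_s `|e s| <= 1 ->
  (forall P : {poly R[i]}, (size P <= N.+1)%N ->
     \sum_s (e s)%:C%C * P.[(y s)%:C%C] = 0) ->
  1 < `|rho| ->
  `|\sum_s (e s)%:C%C / ((y s)%:C%C - (rho + rho^-1))| <=
    2 * (`|rho| ^+ 2 / (`|rho| ^+ 2 - 1) ^+ 2) * `|rho|^-1 ^+ N.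
Proof.
move=> y_le2 e_le1 e_ortho rho_gt1.
have rho_gt0 : 0 < `|rho| by apply: lt_trans rho_gt1.
have rho_neq0 : rho != 0 by rewrite -normr_gt0.
have rho2_gt0 : 0 < `|rho| ^+ 2 - 1 by rewrite subr_gt0 exprn_egt1.
have rhoV_ge0 : 0 <= `|rho|^-1 by rewrite invr_ge0.
have rhoV_le1 : `|rho|^-1 <= 1 by rewrite invf_le1// ltW.
have rho_sg : rho * rho^-1 = 1 by rewrite mulfV.
move: (rho_sg); set sg := rho^-1 => {}rho_sg.
pose a := rho + sg.
have [Q sQ QE] := joukowski_polyP sg sg^*%R N.
(* At the pole v = rho, w = sg, the second summand of Q contains w - sg = 0. *)
have Qa_ge : `|rho| ^+ N * (`|rho| ^+ 2 - 1) ^+ 2 / `|rho| ^+ 3 <= `|Q.[a]|.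
  rewrite QE ?mulfV// subrr mul0r mulr0 addr0 !normrM normrX -mulrA.
  rewrite ler_wpM2l ?exprn_ge0//.
  have -> : (`|rho| ^+ 2 - 1) ^+ 2 / `|rho| ^+ 3 =
     (`|rho| - `|rho|^-1) * (1 - `|rho|^-1 ^+ 2).
    by field; rewrite gt_eqF.
  rewrite ler_pM//.
  - by rewrite subr_ge0 (le_trans rhoV_le1) ?ltW.
  - by rewrite subr_ge0 exprn_ile1.
  - by rewrite -normfV lerB_dist.
  - rewrite mulrC -normCK normfV ger0_norm//.
    by rewrite subr_ge0 exprn_ile1.
have Qa_gt0 : 0 < `|Q.[a]|.
  apply: lt_le_trans Qa_ge.
  by rewrite divr_gt0 ?exprn_gt0// mulr_gt0 ?exprn_gt0.
have Qa_neq0 : Q.[a] != 0 by rewrite -normr_gt0.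
have Qy s : `|Q.[(y s)%:C%C]| <= 2 * `|rho|^-1 * `|(y s)%:C%C - a| /\
     (y s)%:C%C - a != 0.
  (* y s = v + conj v with v on the unit circle. *)
  pose v : R[i] := (y s / 2 +i* Num.sqrt (1 - (y s / 2) ^+ 2))%C.
  have y2_ge0 : 0 <= 1 - (y s / 2) ^+ 2.
    by move: (y_le2 s); rewrite ler_norml => /andP[? ?]; nra.
  have vJ : v * v^*%R = 1.
    apply/eqP; rewrite eq_complex /=.
    rewrite !mulrN opprK [X in _ + X == 0]mulrC addNr eqxx andbT.
    by rewrite -!expr2 sqr_sqrtr// addrC subrK.
  have v1 : `|v| = 1 by apply/eqP; rewrite -(@pexpr_eq1 _ _ 2)// normCK vJ.
  have vD : (y s)%:C%C = v + v^*%R.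
    by apply/eqP; rewrite eq_complex /= subrr eqxx andbT; apply/eqP; field.
  rewrite vD; move: vJ; set w := v^*%R => vw.
  have w1 : `|w| = 1 by rewrite norm_conjC.
  have norm1B u : `|1 - sg^*%R * u^*%R| = `|1 - sg * u|.
    by rewrite -norm_conjC rmorphB rmorphM rmorph1/= !conjCK.
  (* Up to order, these two factors are the moduli of the factors in each of the
     summands of Q. *)
  have yaE : `|v + w - a| = `|rho| * (`|1 - sg * v| * `|1 - sg * w|).
    rewrite -[LHS]normrN -!normrM; congr `|_|; rewrite /a.
    by ring: vw rho_sg.
  have neq1 u : `|u| = 1 -> 1 - sg * u != 0.
    move=> u1; rewrite subr_eq0 eq_sym; apply/eqP => /(congr1 Num.norm).
    rewrite normrM u1 mulr1 normr1 normfV => /eqP.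
    by rewrite invr_eq1 gt_eqF.
  split; last first.
    by rewrite -normr_gt0 yaE !mulr_gt0 ?normr_gt0 ?neq1.
  rewrite QE// yaE (le_trans (ler_normD _ _))// !normrM !normrX v1 w1 !expr1n !mul1r.
  have -> : v - sg = v * (1 - sg * w) by ring: vw.
  have -> : w - sg = w * (1 - sg * v) by ring: vw.
  rewrite !normrM v1 w1 !mul1r norm1B.
  rewrite -[in X in _ + _ * X <= _](conjCK v) -/w norm1B.
  rewrite [2 * _ * _]mulrA -[2 * _ * _]mulrA mulVf ?gt_eqF// mulr1.
  by rewrite [`|_ - sg * w| * _]mulrC -mulr2n mulr_natl.
have [P sP PE] : exists2 P : {poly R[i]}, (size P <= N.+1)%N &
    forall z, Q.[z] = Q.[a] + P.[z] * (z - a).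
  have : root (Q - Q.[a]%:P) a by rewrite rootE hornerD hornerN hornerC subrr.
  move=> /factor_theorem[P PE]; exists P.
    have [->|P0] := eqVneq P 0; first by rewrite size_poly0.
    have : (size (P * ('X - a%:P))%R <= N.+2)%N.
      rewrite -PE (leq_trans (size_polyD _ _))// geq_max sQ size_polyN.
      by rewrite (leq_trans (size_polyC_leq1 _)).
    by rewrite size_mul ?polyXsubC_eq0// size_XsubC addn2.
  move=> z; have := congr1 (horner^~ z) PE.
  rewrite !(hornerD, hornerN, hornerM, hornerX, hornerC) => <-.
  by rewrite addrC subrK.
have -> : \sum_s (e s)%:C%C / ((y s)%:C%C - (rho + rho^-1)) =
    Q.[a]^-1 * \sum_s (e s)%:C%C * (Q.[(y s)%:C%C] / ((y s)%:C%C - a)).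
  transitivity (\sum_s (e s)%:C%C / ((y s)%:C%C - a) +
                Q.[a]^-1 * \sum_s (e s)%:C%C * P.[(y s)%:C%C]).
    by rewrite e_ortho// mulr0 addr0.
  rewrite !mulr_sumr -big_split; apply: eq_bigr => s _ /=.
  rewrite (PE (y s)%:C%C); move: ((e s)%:C%C) ((y s)%:C%C) (Qy s).2 => u z z_neq.
  move: (Q.[a]) (P.[z]) Qa_neq0 => q p q_neq0.
  by field; rewrite q_neq0 z_neq.
rewrite normrM normfV.
have sum_le : `|\sum_s (e s)%:C%C * (Q.[(y s)%:C%C] / ((y s)%:C%C - a))| <=
    2 * `|rho|^-1.
  apply: (le_trans (ler_norm_sum _ _ _)).
  apply: (@le_trans _ _ (\sum_s (`|e s|)%:C%C * (2 * `|rho|^-1))).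
    apply: ler_sum => s _; rewrite !normrM normfV.
    have [Qs ys] := Qy s.
    rewrite ler_pM ?mulr_ge0 ?invr_ge0//.
      by rewrite normc_def /= expr0n addr0 sqrtr_sqr.
    by rewrite ler_pdivrMr ?normr_gt0.
  rewrite -mulr_suml ler_piMl ?mulr_ge0 ?invr_ge0//.
  by rewrite -rmorph_sum/= -(rmorph1 (real_complex R)) lecR.
have -> : 2 * (`|rho| ^+ 2 / (`|rho| ^+ 2 - 1) ^+ 2) * `|rho|^-1 ^+ N =
   (`|rho| ^+ N * (`|rho| ^+ 2 - 1) ^+ 2 / `|rho| ^+ 3)^-1 * (2 * `|rho|^-1).
  rewrite exprVn; have := expf_neq0 N (lt0r_neq0 rho_gt0).
  move: (`|rho| ^+ N) (lt0r_neq0 rho_gt0) (lt0r_neq0 rho2_gt0) => rN.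
  by move: `|rho| => r r_neq0 r2_neq0 rN_neq0; field; rewrite r_neq0 r2_neq0.
rewrite ler_pM ?invr_ge0// lef_pV2 ?posrE//.
by rewrite divr_gt0 ?exprn_gt0// mulr_gt0 ?exprn_gt0.
Qed.
(** * The ellipse parameter R *)

Lemma alphaE (R : realType) (lmin lmax w : R) : lmin < lmax ->
  alpha lmin lmax w =
    (Normc.normc (lmin +i* w)%C + Normc.normc (lmax +i* w)%C) / (lmax - lmin).
Proof.
move=> lt_l; rewrite /alpha; congr (_ / _).
by rewrite /= subrr expr0n addr0 sqrtr_sqr gtr0_norm// subr_gt0.
Qed.

Lemma alpha_gt1 (R : realType) (lmin lmax w : R) : 0 < lmin -> lmin < lmax ->
  1 < alpha lmin lmax w.
Proof.
move=> lmin_gt0 lt_l; rewrite alphaE// ltr_pdivlMr ?subr_gt0// mul1r.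
have le_normc x : x <= Normc.normc (x +i* w)%C.
  by rewrite /= (le_trans (ler_norm x))// -sqrtr_sqr ler_wsqrtr// lerDl sqr_ge0.
have := le_normc lmin; have := le_normc lmax.
by set u := Normc.normc _; set v := Normc.normc _; lra.
Qed.

Lemma Rfun_gt1 (R : realType) (lmin lmax w : R) : 0 < lmin -> lmin < lmax ->
  1 < Rfun lmin lmax w.
Proof.
by move=> l0 lt_l; rewrite ltr_wpDr ?sqrtr_ge0// alpha_gt1.
Qed.

(** The two solutions of rho + 1/rho = a are inverse to each other, so one of
    them has modulus at least 1. *)
Lemma joukowski_preimage (R : rcfType) (a : R[i]) :
  exists2 rho : R[i], 1 <= `|rho| & rho + rho^-1 = a.
Proof.
pose q := sqrtc (a ^+ 2 - 4).
pose u := (a + q) / 2; pose v := (a - q) / 2.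
have uv : u * v = 1.
  have -> : u * v = (a ^+ 2 - q ^+ 2) / 4 by rewrite /u /v; field.
  by rewrite sqr_sqrtc; field.
have uDv : u + v = a by rewrite /u /v; field.
have v_neq0 : v != 0.
  apply/eqP => v0; move: uv; rewrite v0 mulr0 => /eqP.
  by rewrite eq_sym oner_eq0.
have uE : u = v^-1 by apply: (mulIf v_neq0); rewrite uv mulVf.
have [v_ge1|v_lt1] := real_leP (@real1 R[i]) (normr_real v).
  by exists v => //; rewrite -uE addrC.
exists u; last by rewrite [in u^-1]uE invrK.
by rewrite uE normfV invf_ge1 ?normr_gt0// ltW.
Qed.

(** alpha is the major semiaxis of the ellipse with foci -1 and 1 through half
    of the pole: (rho + 1/rho) -+ 2 = (rho -+ 1)^2 / rho, so the distances from the
    pole to 2 and -2 add up to 2 (|rho| + 1/|rho|), while they are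
    4 / (lmax - lmin) times the moduli of lmax + iw and lmin + iw.  Hence
    2 alpha = |rho| + 1/|rho|, whose larger root is R. *)
Lemma Rfun_joukowski (R : realType) (lmin lmax w : R) :
  0 < lmin -> lmin < lmax ->
  exists2 rho : R[i], `|rho| = (Rfun lmin lmax w)%:C%C &
    rho + rho^-1 =
      (- 2 * (lmin + lmax) / (lmax - lmin) +i* (- 4 * w / (lmax - lmin)))%C.
Proof.
move=> l0 lt_l; set a := (_ +i* _)%C.
have D_gt0 : 0 < lmax - lmin by rewrite subr_gt0.
have D_neq0 := lt0r_neq0 D_gt0.
have [rho rho_ge1 rhoE] := joukowski_preimage a.
exists rho => //.
have rho_gt0 : 0 < `|rho| by apply: lt_le_trans rho_ge1.
have rho_neq0 : rho != 0 by rewrite -normr_gt0.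
have a_m2 : `|a - 2| = `|rho - 1| ^+ 2 / `|rho|.
  rewrite -rhoE -normfV -normrX -normrM; congr `|_|; field; exact: rho_neq0.
have a_p2 : `|a + 2| = `|rho + 1| ^+ 2 / `|rho|.
  rewrite -rhoE -normfV -normrX -normrM; congr `|_|; field; exact: rho_neq0.
(* Parallelogram law for rho and 1. *)
have a_foci : `|a + 2| + `|a - 2| = 2 * (`|rho| + `|rho|^-1).
  have conjD1 (c : R[i]) : (rho + c)^*%R = rho^*%R + c^*%R by rewrite rmorphD.
  rewrite a_m2 a_p2 !normCK !conjD1 rmorphN rmorph1.
  have rJ : rho * rho^*%R = `|rho| ^+ 2 by rewrite normCK.
  move: rJ (lt0r_neq0 rho_gt0); move: `|rho| rho^*%R => r z rz r0.
  field: rz; exact: r0.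
have normZc (c : R) (z : R[i]) : 0 <= c ->
    `|- (c%:C%C * z)| = (c * Normc.normc z)%:C%C.
  move=> c_ge0; rewrite normrN normrM rmorphM /=; congr (_ * _).
  by rewrite normc_def /= expr0n addr0 sqrtr_sqr ger0_norm.
have D4_ge0 : 0 <= 4 / (lmax - lmin) by rewrite divr_ge0// ltW.
have a_p2E : `|a + 2| = (4 / (lmax - lmin) * Normc.normc (lmin +i* w)%C)%:C%C.
  rewrite -normZc//; congr `|_|; apply/eqP; rewrite eq_complex /=.
  by apply/andP; split; apply/eqP; field.
have a_m2E : `|a - 2| = (4 / (lmax - lmin) * Normc.normc (lmax +i* w)%C)%:C%C.
  rewrite -normZc//; congr `|_|; apply/eqP; rewrite eq_complex /=.
  by apply/andP; split; apply/eqP; field.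
have [r rhor] : exists r : R, `|rho| = r%:C%C by exists (Normc.normc rho).
rewrite rhor; congr (_%:C%C).
move: rho_ge1 a_foci; rewrite a_p2E a_m2E rhor.
rewrite -(rmorph1 (real_complex R)) lecR => r_ge1.
rewrite -fmorphV -!rmorphD -(rmorph_nat (real_complex R) 2) -rmorphM => /complexI.
have r_gt0 : 0 < r by apply: lt_le_trans r_ge1.
have r_neq0 := lt0r_neq0 r_gt0.
rewrite -mulrDr => foci.
have alphaE : alpha lmin lmax w = (r + r^-1) / 2.
  rewrite alphaE//; apply: (mulfI (_ : 4 != 0 :> R)) => //.
  by rewrite mulrA mulrAC foci; field.
rewrite /Rfun alphaE.
have -> : ((r + r^-1) / 2) ^+ 2 - 1 = ((r - r^-1) / 2) ^+ 2 by field.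
rewrite sqrtr_sqr ger0_norm; first by field.
by rewrite divr_ge0// subr_ge0 (@le_trans _ _ 1)// invf_le1.
Qed.
(** * Bounds for resolvent entries *)

Lemma norm_real_complex (R : rcfType) (x : R) : `|x%:C%C| = `|x|%:C%C :> R[i].
Proof. by rewrite normc_def /= expr0n addr0 sqrtr_sqr. Qed.

Lemma normc_leC (R : rcfType) (z : R[i]) (c : R) :
  (`|z| <= c%:C%C) = (Normc.normc z <= c).
Proof. exact: lecR. Qed.

Lemma resolvent_le (R : realType) (I : finType) (e d : I -> R) (lmin w : R) :
  0 < lmin -> (forall s, lmin <= d s) -> \sum_s `|e s| <= 1 ->
  Normc.normc (\sum_s (e s)%:C%C / (d s +i* w)%C) <=
    1 / Num.sqrt (lmin ^+ 2 + w ^+ 2).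
Proof.
move=> l0 ld e_le1; rewrite -normc_leC; set c := 1 / _.
have s_gt0 : 0 < Num.sqrt (lmin ^+ 2 + w ^+ 2).
  by rewrite sqrtr_gt0 ltr_wpDr ?sqr_ge0// exprn_gt0.
have c_ge0 : 0 <= c by rewrite divr_ge0// ltW.
apply: (le_trans (ler_norm_sum _ _ _)).
apply: (@le_trans _ _ (\sum_s (`|e s|)%:C%C * c%:C%C)).
  apply: ler_sum => s _; rewrite normrM normfV ler_pM ?invr_ge0//.
    by rewrite normc_def /= expr0n addr0 sqrtr_sqr.
  rewrite /c div1r normc_def -fmorphV lecR lef_pV2 ?posrE//.
    rewrite ler_wsqrtr//= lerD2r ler_pXn2r ?nnegrE// ?ltW//.
    exact: lt_le_trans (ld s).
  rewrite sqrtr_gt0 ltr_wpDr ?sqr_ge0//= exprn_gt0//.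
  exact: lt_le_trans (ld s).
rewrite -mulr_suml -rmorph_sum -rmorphM lecR/=.
by rewrite ler_piMl.
Qed.

(** [cauchy_transform_le] after the affine map that sends [lmin, lmax] to
    [-2, 2], under which -iw becomes the point of [Rfun_joukowski]. *)
Lemma resolvent_decay (R : realType) (I : finType) (e d : I -> R)
    (lmin lmax w : R) (N : nat) (Rw := Rfun lmin lmax w) :
  0 < lmin -> lmin < lmax -> (forall s, lmin <= d s <= lmax) ->
  \sum_s `|e s| <= 1 ->
  (forall P : {poly R[i]}, (size P <= N.+1)%N ->
     \sum_s (e s)%:C%C * P.[(d s)%:C%C] = 0) ->
  Normc.normc (\sum_s (e s)%:C%C / (d s +i* w)%C) <=
    8 / (lmax - lmin) * (Rw ^+ 2 / (Rw ^+ 2 - 1) ^+ 2) * (1 / Rw) ^+ N.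
Proof.
move=> l0 lt_l dP e_le1 e_ortho.
have D_gt0 : 0 < lmax - lmin by rewrite subr_gt0.
have D_neq0 := lt0r_neq0 D_gt0.
have Rw_gt1 : 1 < Rw := Rfun_gt1 w l0 lt_l.
have [rho rho_norm rhoE] := Rfun_joukowski w l0 lt_l.
pose y s := (4 * d s - 2 * (lmin + lmax)) / (lmax - lmin).
have y_le2 s : `|y s| <= 2.
  rewrite normrM normfV (gtr0_norm D_gt0) ler_pdivrMr// ler_norml.
  by have /andP[] := dP s; move=> *; apply/andP; split; lra.
have y_ortho (P : {poly R[i]}) : (size P <= N.+1)%N ->
    \sum_s (e s)%:C%C * P.[(y s)%:C%C] = 0.
  move=> sP.
  pose c := 4 / (lmax - lmin).
  pose b := - (2 * (lmin + lmax) / (lmax - lmin)).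
  have c_neq0 : c%:C%C != 0 by rewrite fmorph_eq0 mulf_neq0 ?invr_eq0.
  pose L : {poly R[i]} := c%:C%C%:P * 'X + b%:C%C%:P.
  rewrite -[RHS](e_ortho (P \Po L)).
    apply: eq_bigr => s _; rewrite horner_comp; congr (_ * P.[_]).
    rewrite hornerMXaddC hornerC -rmorphM -rmorphD.
    by congr (_%:C%C); rewrite /y /c /b; field.
  apply: leq_trans sP; rewrite size_comp_poly2//.
  by rewrite size_MXaddC polyC_eq0 (negbTE c_neq0) size_polyC c_neq0.
have rho_gt1 : 1 < `|rho| by rewrite rho_norm -(rmorph1 (real_complex R)) ltcR.
have := cauchy_transform_le y_le2 e_le1 y_ortho rho_gt1.
have -> : \sum_s (e s)%:C%C / ((y s)%:C%C - (rho + rho^-1)) =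
    ((lmax - lmin) / 4)%:C%C * \sum_s (e s)%:C%C / (d s +i* w)%C.
  rewrite rhoE mulr_sumr; apply: eq_bigr => s _.
  rewrite mulrCA; congr (_ * _).
  have -> : (d s +i* w)%C = ((lmax - lmin) / 4)%:C%C *
    ((y s)%:C%C - (- 2 * (lmin + lmax) / (lmax - lmin) +i* (- 4 * w / (lmax - lmin)))%C).
    apply/eqP; rewrite eq_complex /=.
    by apply/andP; split; apply/eqP; rewrite /y; field.
  by rewrite invfM mulVKf// fmorph_eq0 mulf_neq0.
rewrite rho_norm normrM norm_real_complex.
have D4_gt0 : 0 < (lmax - lmin) / 4 by rewrite divr_gt0.
rewrite (gtr0_norm D4_gt0) -/Rw.
have -> : 2 * (Rw%:C%C ^+ 2 / (Rw%:C%C ^+ 2 - 1) ^+ 2) * Rw%:C%C^-1 ^+ N =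
    (2 * (Rw ^+ 2 / (Rw ^+ 2 - 1) ^+ 2) * Rw^-1 ^+ N)%:C%C.
  by rewrite !(rmorphM, rmorphXn, fmorphV, rmorphB, rmorph1, rmorph_nat).
rewrite -ler_pdivlMl ?ltcR// -fmorphV -rmorphM normc_leC => /le_trans; apply.
rewrite le_eqVlt; apply/orP; left; apply/eqP; rewrite div1r.
move: (Rw^-1 ^+ N) => q.
have : Rw ^+ 2 - 1 != 0 by rewrite gt_eqF// subr_gt0 exprn_egt1.
by move: (Rw) => r r2; field; rewrite D_neq0 r2.
Qed.

(** The real part of 1 / ((c + iw) (d - iw)). *)
Definition poisson_kernel2 (R : realType) (c d w : R) : R :=
  (c * d + w ^+ 2) / ((c ^+ 2 + w ^+ 2) * (d ^+ 2 + w ^+ 2)).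

(** The double sum is Re (F * conj F'), for F and F' the two sums on the right. *)
Lemma resolvent_product_le (R : realType) (I : finType)
    (e d e' d' : I -> R) (w : R) :
  (forall s, 0 < d s) -> (forall s, 0 < d' s) ->
  `|\sum_s \sum_r e s * e' r * poisson_kernel2 (d s) (d' r) w| <=
  Normc.normc (\sum_s (e s)%:C%C / (d s +i* w)%C) *
  Normc.normc (\sum_s (e' s)%:C%C / (d' s +i* w)%C).
Proof.
move=> d_gt0 d'_gt0; set F := \sum_s _ / _; set F' := \sum_s _ / _.
have -> : \sum_s \sum_r e s * e' r * poisson_kernel2 (d s) (d' r) w =
    complex.Re (F * F'^*%C).
  rewrite /F /F' rmorph_sum mulr_suml raddf_sum; apply: eq_bigr => s _.
  rewrite mulr_sumr raddf_sum; apply: eq_bigr => r _.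
  rewrite /= /poisson_kernel2.
  have := d_gt0 s; have := d'_gt0 r => r0 s0.
  have := sqr_ge0 w => w0.
  have s2 : 0 < d s ^+ 2 by rewrite exprn_gt0.
  have r2 : 0 < d' r ^+ 2 by rewrite exprn_gt0.
  field. lra.
rewrite -lecR (le_trans (normc_ge_Re _))//.
by rewrite normrM normcJ rmorphM.
Qed.

(** * The integral representation of 1 / (c + d) *)

Lemma continuous_inv_sqrD (R : realType) (c : R) : 0 < c ->
  continuous (fun w : R => 1 / (c ^+ 2 + w ^+ 2)).
Proof.
move=> c_gt0.
have -> : (fun w : R => 1 / (c ^+ 2 + w ^+ 2)) = (fun w => (c ^+ 2 + w ^+ 2)^-1).
  by apply/funext => w; rewrite div1r.
move=> w; apply: (@continuousV R R (fun w => c ^+ 2 + w ^+ 2)).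
  by rewrite gt_eqF// ltr_wpDr ?sqr_ge0// exprn_gt0.
by apply: cvgD; [exact: cvg_cst | exact: exprn_continuous].
Qed.

Lemma is_derive_scaled_atan (R : realType) (c w : R) : 0 < c ->
  is_derive w 1 (fun w => c^-1 * atan (c^-1 * w)) (1 / (c ^+ 2 + w ^+ 2)).
Proof.
move=> c_gt0.
have -> : 1 / (c ^+ 2 + w ^+ 2) = c^-1 *: ((1 + (c^-1 * w) ^+ 2)^-1 * c^-1).
  have c2 : 0 < c ^+ 2 by rewrite exprn_gt0.
  have w2 := sqr_ge0 w.
  rewrite /GRing.scale /=; field; rewrite gt_eqF//= ; lra.
apply: (@is_deriveZ _ _ _ (fun w => atan (c^-1 * w))).
apply: (@is_derive1_comp _ atan (fun w => c^-1 * w)).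
have := @is_deriveZ R R R id c^-1 w 1 1 (is_derive_id _ _).
by rewrite /GRing.scale/= mulr1.
Qed.

Lemma integral_inv_sqrD (R : realType) (c : R) : 0 < c ->
  (\int[lebesgue_measure]_w (1 / (c ^+ 2 + w ^+ 2))%:E)%E = (pi / c)%:E.
Proof.
move=> c_gt0.
have den_gt0 w : 0 < c ^+ 2 + w ^+ 2 by rewrite ltr_wpDr ?sqr_ge0// exprn_gt0.
have f_cont := continuous_inv_sqrD c_gt0.
rewrite ge0_symfun_integralT//; first last.
- by move=> w /=; rewrite sqrrN.
- by move=> w; rewrite divr_ge0// ltW.
have cV_gt0 : 0 < c^-1 by rewrite invr_gt0.
have F_der w := is_derive_scaled_atan w c_gt0.
have F_cont : continuous (fun w : R => c^-1 * atan (c^-1 * w)).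
  by move=> w; apply/differentiable_continuous/derivable1_diffP; apply: ex_derive.
rewrite -set_itvcy.
rewrite (@ge0_continuous_FTC2y _ _ (fun w => c^-1 * atan (c^-1 * w)) 0 (c^-1 * (pi / 2))).
- rewrite mulr0 atan0 mulr0 sube0 -EFinM; congr (_%:E); field.
  by rewrite gt_eqF.
- by move=> w _; rewrite divr_ge0// ltW.
- exact: continuous_subspaceT.
- apply: cvgMr.
  apply: (@cvg_comp _ _ _ _ _ _ (pinfty_nbhs R)); last exact: cvgy_atan.
  exact: gt0_cvgMry.
- by move=> w _; apply: ex_derive.
- by apply: cvg_at_right_filter; exact: F_cont.
- by move=> w _; rewrite derive1E derive_val.
Qed.

(** Partial fractions, based on
    c (d^2 + w^2) + d (c^2 + w^2) = (c + d) (c d + w^2). *)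
Lemma poisson_kernel2E (R : realType) (c d w : R) : 0 < c -> 0 < d ->
  ((poisson_kernel2 c d w)%:E =
    (c / (c + d))%:E * (1 / (c ^+ 2 + w ^+ 2))%:E +
    (d / (c + d))%:E * (1 / (d ^+ 2 + w ^+ 2))%:E)%E.
Proof.
move=> c0 d0; rewrite -!EFinM -EFinD; congr (_%:E).
have c2 : 0 < c ^+ 2 by rewrite exprn_gt0.
have d2 : 0 < d ^+ 2 by rewrite exprn_gt0.
have := sqr_ge0 w => w0.
by rewrite /poisson_kernel2; field; lra.
Qed.

Lemma integrable_inv_sqrD (R : realType) (c : R) : 0 < c ->
  (@lebesgue_measure R).-integrable setT (fun w => (1 / (c ^+ 2 + w ^+ 2))%:E).
Proof.
move=> c0; apply/integrableP; split.
  apply/measurable_EFinP.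
  exact: continuous_measurable_fun (continuous_inv_sqrD c0).
under eq_integral.
  move=> w _; rewrite gee0_abs; first over.
  by rewrite lee_fin divr_ge0// addr_ge0 ?sqr_ge0.
by rewrite integral_inv_sqrD// ltry.
Qed.

Lemma integrable_poisson_kernel2 (R : realType) (c d : R) : 0 < c -> 0 < d ->
  (@lebesgue_measure R).-integrable setT (fun w => (poisson_kernel2 c d w)%:E).
Proof.
move=> c0 d0; under eq_fun do rewrite poisson_kernel2E//.
by apply: integrableD => //; apply: integrableZl => //; exact: integrable_inv_sqrD.
Qed.

Lemma integral_poisson_kernel2 (R : realType) (c d : R) : 0 < c -> 0 < d ->
  (\int[lebesgue_measure]_w (poisson_kernel2 c d w)%:E)%E = (2 * pi / (c + d))%:E.
Proof.
move=> c0 d0; under eq_integral do rewrite poisson_kernel2E//.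
rewrite integralD//; [|apply: integrableZl => //; exact: integrable_inv_sqrD..].
rewrite !integralZl//; [|exact: integrable_inv_sqrD..].
rewrite !integral_inv_sqrD// -!EFinM -EFinD; congr (_%:E).
by field; lra.
Qed.

(** The double sum is 1/(2 pi) times the integral of its kernel counterpart, by
    [integral_poisson_kernel2].  The constant C is kept apart from B so that the
    estimate can be read with C in front of the integral. *)
Lemma kernel_sum_le (R : realType) (I : finType)
    (e d e' d' : I -> R) (C : R) (B : R -> R) :
  (forall s, 0 < d s) -> (forall s, 0 < d' s) ->
  0 <= C -> measurable_fun [set: R] B -> (forall w, 0 <= B w) ->
  (forall w, `|\sum_s \sum_r e s * e' r * poisson_kernel2 (d s) (d' r) w| <=
     C * B w) ->
  (`|\sum_s \sum_r e s * e' r / (d s + d' r)|%:E <=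
    (1 / (2 * pi) * C)%:E * \int[lebesgue_measure]_w (B w)%:E)%E.
Proof.
move=> d0 d'0 C0 mB B0 KB.
pose K (w : R) := \sum_s \sum_r e s * e' r * poisson_kernel2 (d s) (d' r) w.
have pi0 := pi_gt0 R.
have iK : (@lebesgue_measure R).-integrable setT (EFin \o K).
  rewrite /K /comp; under eq_fun do rewrite -sumEFin.
  apply: integrable_sum => // s _; under eq_fun do rewrite -sumEFin.
  apply: integrable_sum => // r _; under eq_fun do rewrite EFinM.
  by apply: integrableZl => //; exact: integrable_poisson_kernel2.
have intK : (\int[lebesgue_measure]_w (K w)%:E)%E =
    (2 * pi * \sum_s \sum_r e s * e' r / (d s + d' r))%:E.
  rewrite /K; under eq_integral do rewrite -sumEFin.
  rewrite integral_sum//; last first.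
    move=> s; under eq_fun do rewrite -sumEFin.
    apply: integrable_sum => // r _; under eq_fun do rewrite EFinM.
    by apply: integrableZl => //; exact: integrable_poisson_kernel2.
  rewrite mulr_sumr -sumEFin; apply: eq_bigr => s _.
  under eq_integral do rewrite -sumEFin.
  rewrite integral_sum//; last first.
    move=> r; under eq_fun do rewrite EFinM.
    by apply: integrableZl => //; exact: integrable_poisson_kernel2.
  rewrite mulr_sumr -sumEFin; apply: eq_bigr => r _.
  under eq_integral do rewrite EFinM.
  rewrite integralZl//; last exact: integrable_poisson_kernel2.
  rewrite integral_poisson_kernel2// -EFinM; congr (_%:E).
  by field; rewrite gt_eqF ?addr_gt0.
rewrite EFinM -muleA -ge0_integralZl_EFin//; last 2 first.
- by move=> w _; rewrite lee_fin.
- exact/measurable_EFinP.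
rewrite div1r lee_pdivlMl ?mulr_gt0// -EFinM -{1}(@gtr0_norm _ (2 * pi)) ?mulr_gt0//.
rewrite -normrM -abse_EFin -intK.
apply: (le_trans (le_abse_integral _ _ _)) => //; first by case/integrableP: iK.
apply: ge0_le_integral => //.
- by apply: measurableT_comp => //; case/integrableP: iK.
- apply/measurable_EFinP; exact: measurable_funM.
- by move=> w _; exact: KB.
Qed.

(** * Measurability of the bounds *)

(** On positive arguments the inverse is exp (- ln), a composition of measurable
    functions. *)
Lemma measurable_fun_inv (d : measure_display) (T : measurableType d)
    (R : realType) (f : T -> R) :
  measurable_fun [set: T] f -> (forall w, 0 < f w) ->
  measurable_fun [set: T] (fun w => (f w)^-1).
Proof.
move=> mf f0.
have -> : (fun w => (f w)^-1) = (fun w => expR (- ln (f w))).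
  by apply/funext => w; rewrite expRN lnK ?posrE.
apply: measurableT_comp; first exact: measurable_expR.
by apply: measurable_funN; apply: measurableT_comp.
Qed.

Lemma measurable_fun_sqrt (d : measure_display) (T : measurableType d)
    (R : realType) (f : T -> R) :
  measurable_fun [set: T] f -> measurable_fun [set: T] (fun w => Num.sqrt (f w)).
Proof.
move=> mf; apply: measurableT_comp => //.
by apply: continuous_measurable_fun; exact: sqrt_continuous.
Qed.

Lemma measurable_Rfun (R : realType) (lmin lmax : R) : lmin < lmax ->
  measurable_fun [set: R] (Rfun lmin lmax).
Proof.
move=> lt_l.
have malpha : measurable_fun [set: R] (alpha lmin lmax).
  have -> : alpha lmin lmax = fun w => (Num.sqrt (lmin ^+ 2 + w ^+ 2) +
      Num.sqrt (lmax ^+ 2 + w ^+ 2)) / (lmax - lmin).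
    by apply/funext => w; rewrite alphaE.
  apply: measurable_funM => //; apply: measurable_funD; apply: measurable_fun_sqrt.
    by apply: measurable_funD => //; exact: measurable_funX.
  by apply: measurable_funD => //; exact: measurable_funX.
apply: measurable_funD => //; apply: measurable_fun_sqrt.
by apply: measurable_funB => //; exact: measurable_funX.
Qed.

Lemma measurable_decay_factor (R : realType) (lmin lmax : R)
    (Rw := Rfun lmin lmax) :
  0 < lmin -> lmin < lmax ->
  measurable_fun [set: R] (fun w => Rw w ^+ 2 / (Rw w ^+ 2 - 1) ^+ 2).
Proof.
move=> l0 lt_l; have mR := measurable_Rfun lt_l.
apply: measurable_funM; first exact: measurable_funX.
apply: measurable_fun_inv.
  by apply: measurable_funX; apply: measurable_funB => //; exact: measurable_funX.
by move=> w; rewrite exprn_gt0// subr_gt0 exprn_egt1// Rfun_gt1.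
Qed.

(** * The inverse of the Kronecker sum *)

Lemma posdef_eigenvalue_gt0 (R : realType) (n : nat) (M : 'M[R]_n) (a : R) :
  posdefmx M -> eigenvalue M a -> 0 < a.
Proof.
move=> M_posdef /eigenvalueP[v vM v_neq0].
have vT_neq0 : v^T != 0 by rewrite trmx_eq0.
have := M_posdef _ vT_neq0; rewrite trmxK vM -scalemxAl mxE.
have v2_ge0 : 0 <= (v *m v^T) 0 0.
  by rewrite mxE sumr_ge0// => i _; rewrite mxE -expr2 sqr_ge0.
move: v2_ge0; rewrite le_eqVlt => /orP[/eqP <-|v2_gt0].
  by rewrite mulr0 ltxx.
by rewrite pmulr_lgt0.
Qed.

(** The right-hand side is a right inverse, because kronsum M multiplies
    E_s (x) E_r by d_s + d_r and these tensor products sum to the identity. *)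
Lemma invmx_kronsumE (R : realType) (n : nat) (M : 'M[R]_n)
    (d : 'I_n -> R) (E : 'I_n -> 'M[R]_n) :
  (forall s, M *m E s = d s *: E s) -> \sum_s E s = 1%:M -> (forall s, 0 < d s) ->
  invmx (kronsum M) =
    \sum_s \sum_r (d s + d r)^-1 *: tensmx (E s) (E r).
Proof.
move=> ME sumE d_gt0; set X := \sum_s _.
have SX : kronsum M *m X = 1%:M.
  rewrite /X mulmx_sumr.
  transitivity (\sum_s \sum_r tensmx (E s) (E r)).
    apply: eq_bigr => s _; rewrite mulmx_sumr; apply: eq_bigr => r _.
    rewrite -scalemxAr mulmxDl !tensmx_mul !mul1mx !ME.
    apply/matrixP => i j; rewrite !mxE.
    by field; rewrite gt_eqF// addr_gt0.
  apply/matrixP => i j; rewrite summxE.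
  under eq_bigr do rewrite summxE; under eq_bigr do under eq_bigr do rewrite mxE.
  under eq_bigr do rewrite -mulr_sumr.
  rewrite -mulr_suml -!summxE sumE !mxE -natrM mulnb; congr (_%:R).
  rewrite -(inj_eq (can_inj (@mxtens_unindexK n n))) -xpair_eqE /=.
  by congr (_ : nat).
have S_unit : kronsum M \in unitmx by case: (mulmx1_unit SX).
by rewrite -[invmx _]mulmx1 -SX mulKmx.
Qed.

Lemma outer_indexE (n k : nat) : outer_index n k.+1 = (k %/ n + 1)%N.
Proof. by rewrite /outer_index subn1. Qed.

Lemma inner_indexE (n k : nat) : inner_index n k.+1 = (k %% n + 1)%N.
Proof.
by rewrite /inner_index subn1 /= {1}(divn_eq k n) mulnC -addnS addKn addn1.
Qed.

(** * Decay of the entries of the inverse *)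

Theorem proposition2p2 (R : realType) (n : nat) (M : 'M[R]_n) (lmin lmax : R)
    (M_sym : M^T = M) (M_posdef : posdefmx M) (M_tridiag : tridiagmx M)
    (lminP : min_eigenvalue M lmin) (lmaxP : max_eigenvalue M lmax)
    (k t : 'I_(n * n)) :
  let Sinv := invmx (kronsum M) in
  let j := outer_index n t.+1 in
  let i := inner_index n t.+1 in
  let m := outer_index n k.+1 in
  let l := inner_index n k.+1 in
  let Rw := Rfun lmin lmax in
  [/\ (lmax != lmin -> i <> l -> j <> m ->
        (`|Sinv k t|%:E <=
          (1 / (2 * pi) * (64 / `|lmax - lmin| ^+ 2))%:E *
          \int[lebesgue_measure]_w
            ((Rw w ^+ 2 / (Rw w ^+ 2 - 1) ^+ 2) ^+ 2 *
             (1 / Rw w) ^+ (`|i - l| + `|j - m| - 2)%N)%:E)%E),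
      (lmax != lmin -> (i = l /\ j <> m) \/ (i <> l /\ j = m) ->
        (`|Sinv k t|%:E <=
          (1 / (2 * pi) * (8 / `|lmax - lmin|))%:E *
          \int[lebesgue_measure]_w
            (1 / Num.sqrt (lmin ^+ 2 + w ^+ 2) *
             (Rw w ^+ 2 / (Rw w ^+ 2 - 1) ^+ 2) *
             (1 / Rw w) ^+ (`|i - l| + `|j - m| - 1)%N)%:E)%E) &
      (i = l -> j = m ->
        (`|Sinv k t|%:E <=
          (1 / (2 * pi))%:E *
          \int[lebesgue_measure]_w (1 / (lmin ^+ 2 + w ^+ 2))%:E)%E /\
        ((1 / (2 * pi))%:E *
          \int[lebesgue_measure]_w (1 / (lmin ^+ 2 + w ^+ 2))%:E =
         (1 / (2 * lmin))%:E)%E)].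
Proof.
move=> Sinv j i m l Rw.
have lmin_gt0 := posdef_eigenvalue_gt0 M_posdef lminP.1.
have lmin_le_lmax : lmin <= lmax := lminP.2 _ lmaxP.1.
have [d [E [d_eig ME sumE E_le1]]] := sym_spectral_resolution M_sym.
have lmin_d s : lmin <= d s := lminP.2 _ (d_eig s).
have d_bounds s : lmin <= d s <= lmax by rewrite lmin_d lmaxP.2.
have d_gt0 s : 0 < d s := lt_le_trans lmin_gt0 (lmin_d s).
pose m0 := (mxtens_unindex k).1; pose l0 := (mxtens_unindex k).2.
pose j0 := (mxtens_unindex t).1; pose i0 := (mxtens_unindex t).2.
have mE : m = (m0 + 1)%N by rewrite /m outer_indexE.
have lE : l = (l0 + 1)%N by rewrite /l inner_indexE.
have jE : j = (j0 + 1)%N by rewrite /j outer_indexE.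
have iE : i = (i0 + 1)%N by rewrite /i inner_indexE.
(* m0, j0 index the outer factor and l0, i0 the inner one, counted from 0. *)
have SinvE : Sinv k t =
    \sum_s \sum_r E s m0 j0 * E r l0 i0 / (d s + d r).
  rewrite /Sinv (invmx_kronsumE ME sumE d_gt0) summxE.
  apply: eq_bigr => s _; rewrite summxE; apply: eq_bigr => r _.
  by rewrite !mxE mulrC.
have K_le w := resolvent_product_le (fun s => E s m0 j0) (fun r => E r l0 i0) w
  d_gt0 d_gt0.
pose F (a b : 'I_n) w := Normc.normc (\sum_s (E s a b)%:C%C / (d s +i* w)%C).
have F_le a b w : F a b w <= 1 / Num.sqrt (lmin ^+ 2 + w ^+ 2).
  exact: (resolvent_le (e := fun s => E s a b)).
have F_decay a b w : lmin < lmax -> a <> b ->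
    F a b w <= 8 / (lmax - lmin) * (Rw w ^+ 2 / (Rw w ^+ 2 - 1) ^+ 2) *
      (1 / Rw w) ^+ (`|a - b| - 1)%N.
  move=> lt_l ab; apply: (resolvent_decay (e := fun s => E s a b)) => //.
  have ab_gt0 : (0 < `|a - b|)%N by rewrite lt0n distn_eq0; apply/eqP => /val_inj.
  by move=> P; rewrite subn1 prednK//; exact: (tridiag_poly0 M_tridiag ME sumE).
have F_ge0 a b w : 0 <= F a b w.
  by rewrite /F; case: (\sum_s _) => x y; exact: sqrtr_ge0.
have bound (C : R) (B : R -> R) : 0 <= C -> measurable_fun [set: R] B ->
    (forall w, 0 <= B w) -> (forall w, F m0 j0 w * F l0 i0 w <= C * B w) ->
    (`|Sinv k t|%:E <= (1 / (2 * pi) * C)%:E * \int[lebesgue_measure]_w (B w)%:E)%E.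
  move=> C0 mB B0 FB; rewrite SinvE; apply: kernel_sum_le => // w.
  exact: le_trans (K_le w) (FB w).
have lt_lE : lmax != lmin -> lmin < lmax by rewrite lt_neqAle eq_sym => ->.
have dist_il : `|i - l|%N = `|l0 - i0|%N by rewrite iE lE distnDr distnC.
have dist_jm : `|j - m|%N = `|m0 - j0|%N by rewrite jE mE distnDr distnC.
have ne_il : i <> l -> l0 <> i0.
  by move=> il l0i0; apply: il; rewrite iE lE l0i0.
have ne_jm : j <> m -> m0 <> j0.
  by move=> jm m0j0; apply: jm; rewrite jE mE m0j0.
have sqrt_gt0 w : 0 < Num.sqrt (lmin ^+ 2 + w ^+ 2).
  by rewrite sqrtr_gt0 ltr_wpDr ?sqr_ge0// exprn_gt0.
have q_ge0 w : 0 <= Rw w ^+ 2 / (Rw w ^+ 2 - 1) ^+ 2.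
  by rewrite divr_ge0 ?sqr_ge0.
have Rw_ge0 w : lmin < lmax -> 0 <= 1 / Rw w.
  by move=> lt_l; rewrite divr_ge0// ltW// (lt_trans ltr01)// Rfun_gt1.
have mRwV N : lmin < lmax -> measurable_fun [set: R] (fun w => (1 / Rw w) ^+ N).
  move=> lt_l; apply: measurable_funX; apply: measurable_funM => //.
  apply: measurable_fun_inv; first exact: measurable_Rfun.
  by move=> w; rewrite (lt_trans ltr01)// Rfun_gt1.
split.
- move=> /lt_lE lt_l il jm.
  have D_gt0 : 0 < lmax - lmin by rewrite subr_gt0.
  have mq := measurable_decay_factor lmin_gt0 lt_l.
  rewrite (gtr0_norm D_gt0); apply: bound => [|||w].
  + by rewrite divr_ge0 ?sqr_ge0.
  + by apply: measurable_funM; [exact: measurable_funX|exact: mRwV].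
  + by move=> w; rewrite mulr_ge0 ?exprn_ge0 ?Rw_ge0.
  have := ler_pM (F_ge0 _ _ w) (F_ge0 _ _ w) (F_decay _ _ w lt_l (ne_jm jm))
            (F_decay _ _ w lt_l (ne_il il)).
  move=> /le_trans; apply; rewrite dist_il dist_jm.
  have -> : (`|l0 - i0| + `|m0 - j0| - 2 = (`|m0 - j0| - 1) + (`|l0 - i0| - 1))%N.
    have : (`|l0 - i0| != 0)%N by rewrite distn_eq0; apply/eqP => /val_inj/(ne_il il).
    have : (`|m0 - j0| != 0)%N by rewrite distn_eq0; apply/eqP => /val_inj/(ne_jm jm).
    lia.
  rewrite exprD le_eqVlt; apply/orP; left; apply/eqP.
  move: (1 / Rw w) (Rw w ^+ 2 / _) => r q.
  by field; rewrite gt_eqF.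
- move=> /lt_lE lt_l cases.
  have D_gt0 : 0 < lmax - lmin by rewrite subr_gt0.
  have mq := measurable_decay_factor lmin_gt0 lt_l.
  rewrite (gtr0_norm D_gt0); apply: bound => [|||w].
  + by rewrite divr_ge0// ltW.
  + apply: measurable_funM; last exact: mRwV.
    apply: measurable_funM => //; apply: measurable_funM => //.
    apply: measurable_fun_inv => //; apply: measurable_fun_sqrt.
    by apply: measurable_funD => //; exact: measurable_funX.
  + move=> w; apply: mulr_ge0; last by rewrite exprn_ge0 ?Rw_ge0.
    by apply: mulr_ge0 (q_ge0 w); rewrite divr_ge0 ?sqrtr_ge0.
  rewrite dist_il dist_jm.
  case: cases => [[il jm]|[il jm]].
    have -> : (`|l0 - i0| = 0)%N by rewrite -dist_il il distnn.
    have := ler_pM (F_ge0 _ _ w) (F_ge0 _ _ w) (F_decay _ _ w lt_l (ne_jm jm))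
            (F_le l0 i0 w).
    move=> /le_trans; apply; rewrite le_eqVlt; apply/orP; left; apply/eqP.
    rewrite add0n; move: (1 / Rw w) (Rw w ^+ 2 / _) (8 / _) (1 / _) => r q c g; ring.
  have -> : (`|m0 - j0| = 0)%N by rewrite -dist_jm jm distnn.
  have := ler_pM (F_ge0 _ _ w) (F_ge0 _ _ w) (F_le m0 j0 w)
            (F_decay _ _ w lt_l (ne_il il)).
  move=> /le_trans; apply; rewrite le_eqVlt; apply/orP; left; apply/eqP.
  rewrite addn0; move: (1 / Rw w) (Rw w ^+ 2 / _) (8 / _) (1 / _) => r q c g; ring.
- move=> il jm; split.
    rewrite -[X in (X%:E * _)%E]mulr1; apply: bound => // [|w|w].
    + exact: continuous_measurable_fun (continuous_inv_sqrD lmin_gt0).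
    + by rewrite divr_ge0// addr_ge0 ?sqr_ge0.
    + have := ler_pM (F_ge0 _ _ w) (F_ge0 _ _ w) (F_le m0 j0 w) (F_le l0 i0 w).
      move=> /le_trans; apply; rewrite mulf_div mulr1 mul1r -expr2 sqr_sqrtr//.
      by rewrite addr_ge0 ?sqr_ge0.
  rewrite integral_inv_sqrD// -EFinM; congr (_%:E).
  move: pi (lt0r_neq0 (pi_gt0 R)) => p p_neq0.
  by field; rewrite (gt_eqF lmin_gt0).
Qed.
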